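(* Let $T\subseteq \mathrm{Trc}=\mathbb{D}^\omega$ be a set of traces that is stable under renamings, i.e. $\sigma(T)=T$ for every bijection $\sigma:\mathbb{D}\to\mathbb{D}$ (applied letterwise to traces). Then $T$ is completely monitorable if and only if there is a closed formula $\varphi\in\mathrm{HML}^d$ with $[\![\varphi]\!]=T$.
   Context: **Data and traces.** Fix a countably infinite set $\mathbb{D}$ (data values) whose only predicate is equality, which is decidable. $\mathrm{Trc}=\mathbb{D}^\omega$ is the set of (infinite) traces, $\mathbb{D}^*$ the set of finite traces. **Logic.** Let $\mathrm{DVar}$ be a countably infinite set of data variables and $\star\notin\mathrm{DVar}$ a placeholder for the current data value. Constraint expressions: $b::=\mathsf{true}\mid e=f\mid\neg b\mid b\wedge b$ with $e,f\in\mathrm{DVar}\cup\{\star\}$. Formulae of $\mathrm{HML}^d$: $\varphi::=\mathsf{tt}\mid\mathsf{ff}\mid\langle b\rangle\varphi\mid[b]\varphi\mid\exists x.\varphi\mid\forall x.\varphi\mid\varphi\vee\varphi\mid\varphi\wedge\varphi$. For a data environment $\delta$ (partial function $\mathrm{DVar}\rightharpoonup\mathbb{D}$ with finite domain containing the free data variables of $\varphi$), $[\![\varphi,\delta]\!]\subseteq\mathrm{Trc}$ is given by: $[\![\mathsf{tt},\delta]\!]=\mathrm{Trc}$; $[\![\mathsf{ff},\delta]\!]=\varnothing$; $[\![\langle b\rangle\varphi,\delta]\!]=\{du\mid d\in\mathbb{D},\ b\text{ is true under }\delta[\star\mapsto d],\ u\in[\![\varphi,\delta]\!]\}$; $[\![[b]\varphi,\delta]\!]=\{du\mid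 \text{if }b\text{ is true under }\delta[\star\mapsto d]\text{ then }u\in[\![\varphi,\delta]\!]\}$; $[\![\exists x.\varphi,\delta]\!]=\bigcup_{d\in\mathbb{D}}[\![\varphi,\delta[x\mapsto d]]\!]$; $[\![\forall x.\varphi,\delta]\!]=\bigcap_{d\in\mathbb{D}}[\![\varphi,\delta[x\mapsto d]]\!]$; $\vee,\wedge$ are union and intersection. For closed $\varphi$ (no free data variable) the semantics does not depend on $\delta$ and is written $[\![\varphi]\!]$. **Monitors.** A monitor is an object $m$ (no computability requirement) with two predicates $\mathbf{acc}(m,w)$, $\mathbf{rej}(m,w)$ on finite traces $w\in\mathbb{D}^*$ such that (consistency) no $w$ satisfies both, and (irrevocability) if $w$ is a prefix of $w'$ then $\mathbf{acc}(m,w)\Rightarrow\mathbf{acc}(m,w')$ and $\mathbf{rej}(m,w)\Rightarrow\mathbf{rej}(m,w')$. For $t\in\mathrm{Trc}$, $\mathbf{acc}(m,t)$ (resp. $\mathbf{rej}(m,t)$) holds iff it holds for some finite prefix of $t$. $T\subseteq\mathrm{Trc}$ is completely monitorable if there is a monitor $m$ such that for all $t\in\mathrm{Trc}$: $t\in T\Rightarrow\mathbf{acc}(m,t)$ and $t\notin T\Rightarrow\mathbf{rej}(m,t)$. *)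

(* Defs.v *)
From mathcomp Require Import all_boot finmap all_classical.

Set Implicit Arguments.
Unset Strict Implicit.
Unset Printing Implicit Defensive.

Local Open Scope classical_set_scope.

Definition trace (D : Type) : Type := nat -> D.

Definition scons (D : Type) (d : D) (u : trace D) : trace D :=
  fun n => if n is k.+1 then u k else d.

Inductive dexpr (DVar : Type) : Type :=
| DStar
| DVarE of DVar.

Inductive bexpr (DVar : Type) : Type :=
| BTrue
| BEq of dexpr DVar & dexpr DVar
| BNot of bexpr DVar
| BAnd of bexpr DVar & bexpr DVar.

Inductive hmld (DVar : Type) : Type :=
| Tt
| Ff
| Dia of bexpr DVar & hmld DVar
| Box of bexpr DVar & hmld DVar
| Ex of DVar & hmld DVar
| All of DVar & hmld DVar
| Or of hmld DVar & hmld DVar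
| And of hmld DVar & hmld DVar.

Definition dfv (DVar : choiceType) (e : dexpr DVar) : {fset DVar} :=
  if e is DVarE x then [fset x]%fset else fset0.

Fixpoint bfv (DVar : choiceType) (b : bexpr DVar) : {fset DVar} :=
  match b with
  | BTrue => fset0
  | BEq e f => (dfv e `|` dfv f)%fset
  | BNot b1 => bfv b1
  | BAnd b1 b2 => (bfv b1 `|` bfv b2)%fset
  end.

Fixpoint fv (DVar : choiceType) (phi : hmld DVar) : {fset DVar} :=
  match phi with
  | Tt | Ff => fset0
  | Dia b psi | Box b psi => (bfv b `|` fv psi)%fset
  | Ex x psi | All x psi => (fv psi `\ x)%fset
  | Or psi1 psi2 | And psi1 psi2 => (fv psi1 `|` fv psi2)%fset
  end.

Definition closed_formula (DVar : choiceType) (phi : hmld DVar) : Prop :=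
  fv phi = fset0.

(* Environments are finite maps; d is the value of the placeholder. The value
   None arises only for a variable outside the domain of delta, hence never
   when that domain contains the free variables. *)
Definition dval (DVar : choiceType) (D : Type) (delta : {fmap DVar -> D})
    (d : D) (e : dexpr DVar) : option D :=
  match e with
  | DStar => Some d
  | DVarE x => delta.[? x]%fmap
  end.

Fixpoint bholds (DVar : choiceType) (D : eqType) (delta : {fmap DVar -> D})
    (d : D) (b : bexpr DVar) : bool :=
  match b with
  | BTrue => true
  | BEq e f => dval delta d e == dval delta d f
  | BNot b1 => ~~ bholds delta d b1
  | BAnd b1 b2 => bholds delta d b1 && bholds delta d b2
  end.

(* Meaningful when the domain of delta contains fv phi. *)
Fixpoint sem (DVar : choiceType) (D : eqType) (phi : hmld DVar)
    (delta : {fmap DVar -> D}) : set (trace D) :=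
  match phi with
  | Tt => setT
  | Ff => set0
  | Dia b psi => [set t | exists d u,
      [/\ t = scons d u, bholds delta d b & sem psi delta u]]
  | Box b psi => [set t | exists d u,
      t = scons d u /\ (bholds delta d b -> sem psi delta u)]
  | Ex x psi => \bigcup_(d in [set: D]) sem psi delta.[x <- d]%fmap
  | All x psi => \bigcap_(d in [set: D]) sem psi delta.[x <- d]%fmap
  | Or psi1 psi2 => sem psi1 delta `|` sem psi2 delta
  | And psi1 psi2 => sem psi1 delta `&` sem psi2 delta
  end.

(* For closed phi the environment is immaterial; we take the empty one. *)
Definition closed_sem (DVar : choiceType) (D : eqType) (phi : hmld DVar) :
  set (trace D) := sem phi fmap0.

Record monitor (D : eqType) : Type := Monitor {
  acc : seq D -> Prop;
  rej : seq D -> Prop;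
  monitor_consistent : forall w, ~ (acc w /\ rej w);
  acc_irrevocable : forall w w', prefix w w' -> acc w -> acc w';
  rej_irrevocable : forall w w', prefix w w' -> rej w -> rej w'
}.

(* mkseq t n is the prefix of length n of the trace t. *)
Definition acc_trace (D : eqType) (m : monitor D) (t : trace D) : Prop :=
  exists n, acc m (mkseq t n).

Definition rej_trace (D : eqType) (m : monitor D) (t : trace D) : Prop :=
  exists n, rej m (mkseq t n).

Definition completely_monitorable (D : eqType) (T : set (trace D)) : Prop :=
  exists m : monitor D, forall t : trace D,
    (T t -> acc_trace m t) /\ (~ T t -> rej_trace m t).

Definition rename (D : Type) (sigma : D -> D) (t : trace D) : trace D :=
  fun n => sigma (t n).

Definition stable_under_renamings (D : Type) (T : set (trace D)) : Prop :=
  forall sigma : D -> D, bijective sigma -> rename sigma @` T = T.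

(* Main.v *)
Require Import Defs.
From mathcomp Require Import all_boot finmap all_classical.

(** A closed formula only inspects a prefix whose length is its modal depth, so
    it is monitored by waiting for that prefix.  Conversely, a completely
    monitorable set is decided, on each trace, by a finite prefix.  Modulo
    renamings, a finite word has only finitely many one-letter extensions
    (repeat an earlier letter, or take one fixed fresh letter), so König's
    lemma gives one length [n] that decides all traces.  Two traces with the
    same equality pattern on their first [n] letters differ there by a renaming,
    so a stable set is a finite union of equality patterns of length [n], and
    each pattern is expressed by binding the successive letters to distinct
    variables. *)

Set Implicit Arguments.
Unset Strict Implicit.
Unset Printing Implicit Defensive.

Local Open Scope classical_set_scope.

Definition agree (D : Type) (n : nat) (t u : trace D) : Prop :=
  forall i, i < n -> t i = u i.

Lemma agree_sym (D : Type) n (t u : trace D) : agree n t u -> agree n u t.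
Proof. by move=> tu i lin; rewrite tu. Qed.

Lemma agree_trans (D : Type) n (t u v : trace D) :
  agree n t u -> agree n u v -> agree n t v.
Proof. by move=> tu uv i lin; rewrite tu ?uv. Qed.

Lemma agree_leq (D : Type) m n (t u : trace D) :
  m <= n -> agree n t u -> agree m t u.
Proof. by move=> lmn tu i lim; apply: tu; apply: leq_trans lim lmn. Qed.

Lemma agree_mkseq (D : Type) n (t u : trace D) :
  agree n t u <-> mkseq t n = mkseq u n.
Proof.
split=> [tu|tu i lin].
  by apply/eq_in_map => i; rewrite mem_iota add0n; apply: tu.
by rewrite -(nth_mkseq (t i) t lin) tu nth_mkseq.
Qed.

(** Equivalently, the cylinder of length [n] around [t] lies inside [T] or inside its complement. *)
Definition determined (D : Type) (T : set (trace D)) n (t : trace D) : Prop :=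
  forall u, agree n t u -> (T u <-> T t).

Lemma determined_leq (D : Type) (T : set (trace D)) m n t :
  m <= n -> determined T m t -> determined T n t.
Proof. by move=> lmn dt u tu; apply: dt; apply: agree_leq tu. Qed.

Lemma determined_agree (D : Type) (T : set (trace D)) n t u :
  agree n t u -> determined T n t -> determined T n u.
Proof.
move=> tu dt v uv; rewrite (dt v (agree_trans tu uv)).
by rewrite (dt u tu).
Qed.

(** [n] is the modal depth: only modalities consume a letter. It is chosen before [delta], so the
    quantifier cases can use the induction hypothesis in an extended environment. *)
Lemma sem_agree (DVar : choiceType) (D : eqType) (phi : hmld DVar) :
  exists n, forall (delta : {fmap DVar -> D}) t u,
    agree n t u -> sem phi delta t -> sem phi delta u.
Proof.
have sconsE (t : trace D) : t = scons (t 0) (fun i => t i.+1).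
  by apply: funext; case.
elim: phi => [||b p [n IH]|b p [n IH]|x p [n IH]|x p [n IH]|
    p [n IHp] q [m IHq]|p [n IHp] q [m IHq]].
- by exists 0.
- by exists 0.
- exists n.+1 => delta t u tu [d [v [tE bd pv]]].
  exists d, (fun i => u i.+1); split=> //.
    by rewrite {1}(sconsE u) -tu // tE.
  by apply: IH pv => i lin; rewrite -tu // tE.
- exists n.+1 => delta t u tu [d [v [tE pv]]].
  exists d, (fun i => u i.+1); split=> [|bd].
    by rewrite {1}(sconsE u) -tu // tE.
  by apply: IH (pv bd) => i lin; rewrite -tu // tE.
- by exists n => delta t u tu [d _ pd]; exists d => //; apply: IH pd.
- by exists n => delta t u tu pt d _; apply: IH (pt d _).
- exists (maxn n m) => delta t u tu [pt|qt]; [left|right].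
    by apply: IHp pt; apply: agree_leq tu; apply: leq_maxl.
  by apply: IHq qt; apply: agree_leq tu; apply: leq_maxr.
- exists (maxn n m) => delta t u tu [pt qt]; split.
    by apply: IHp pt; apply: agree_leq tu; apply: leq_maxl.
  by apply: IHq qt; apply: agree_leq tu; apply: leq_maxr.
Qed.

Lemma uniformly_determined_monitorable (D : eqType) (T : set (trace D)) n :
  (forall t, determined T n t) -> completely_monitorable T.
Proof.
move=> det.
(* Once [n] letters are read, any trace extending them serves as witness: by [det] they all lie on
   the same side of [T]. *)
pose verdict (S : set (trace D)) (w : seq D) :=
  n <= size w /\ exists2 t, S t & mkseq t n = take n w.
have mono S w w' : prefix w w' -> verdict S w -> verdict S w'.
  move=> /prefixP[v ->] [lnw [t St tw]]; split.
    by rewrite size_cat (leq_trans lnw) // leq_addr.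
  by exists t => //; rewrite tw takel_cat.
have cons w : ~ (verdict T w /\ verdict (~` T) w).
  move=> [[_ [t Tt tw]] [_ [u nTu uw]]]; apply: nTu.
  by rewrite (det t u) //; apply/agree_mkseq; rewrite tw.
have self S t : S t -> verdict S (mkseq t n).
  move=> St; split; first by rewrite size_mkseq.
  by exists t; rewrite // take_oversize // size_mkseq.
exists (Monitor cons (@mono T) (@mono (~` T))) => t.
by split=> Tt; exists n; apply: self.
Qed.

(** The prefix of [t] on which [m] decides works: a trace sharing it gets the same verdict, and an
    opposite verdict would, by irrevocability, clash with it on the longer of the two prefixes. *)
Lemma monitorable_determined (D : eqType) (T : set (trace D)) t :
  completely_monitorable T -> exists n, determined T n t.
Proof.
move=> [m mT].
have clash (u : trace D) n k :
    acc m (mkseq u n) -> rej m (mkseq u k) -> False.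
  have pre i j : i <= j -> prefix (mkseq u i) (mkseq u j).
    move=> lij; rewrite -(subnKC lij) /mkseq iotaD map_cat.
    exact: prefix_prefix.
  move=> an rk; apply: (@monitor_consistent _ m (mkseq u (maxn n k))); split.
    by apply: acc_irrevocable an; apply: pre; apply: leq_maxl.
  by apply: rej_irrevocable rk; apply: pre; apply: leq_maxr.
have [Tt|nTt] := pselect (T t).
  have [n an] := (mT t).1 Tt; exists n => u /agree_mkseq tu.
  split=> // _; apply: contrapT => /(mT u).2[k].
  by apply: (clash _ n); rewrite -tu.
have [n rn] := (mT t).2 nTt; exists n => u /agree_mkseq tu.
split=> // /(mT u).1[k ak]; exfalso.
by apply: (clash _ _ n ak); rewrite -tu.
Qed.

Lemma stable_rename (D : Type) (T : set (trace D)) sigma t :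
  stable_under_renamings T -> bijective sigma ->
  T (rename sigma t) <-> T t.
Proof.
move=> stT bs; split=> [|Tt]; last by rewrite -(stT _ bs); exists t.
rewrite -{1}(stT _ bs) => -[u Tu us].
suff -> : t = u by [].
apply: funext => i; apply: (bij_inj bs).
exact: esym (congr1 (fun v : trace D => v i) us).
Qed.

Lemma determined_rename (D : Type) (T : set (trace D)) sigma n t :
  stable_under_renamings T -> bijective sigma ->
  determined T n (rename sigma t) -> determined T n t.
Proof.
move=> stT bs dt u tu.
rewrite -(stable_rename u stT bs) -(stable_rename t stT bs).
by apply: dt => i lin; rewrite /rename tu.
Qed.

Definition swap (D : eqType) (x y z : D) : D :=
  if z == x then y else if z == y then x else z.

Lemma swapL (D : eqType) (x y : D) : swap x y x = y.
Proof. by rewrite /swap eqxx. Qed.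

Lemma swapxx (D : eqType) (x z : D) : swap x x z = z.
Proof. by rewrite /swap; case: eqP. Qed.

Lemma swapD (D : eqType) (x y z : D) : z <> x -> z <> y -> swap x y z = z.
Proof. by rewrite /swap => /eqP/negPf -> /eqP/negPf ->. Qed.

Lemma swap_bij (D : eqType) (x y : D) : bijective (swap x y).
Proof.
suff sK : involutive (swap x y) by exists (swap x y).
move=> z; rewrite /swap; have [->|zx] := eqVneq z x.
  by rewrite eqxx; case: eqP.
have [->|zy] := eqVneq z y; first by rewrite eqxx.
by rewrite (negPf zx) (negPf zy).
Qed.

(** The renaming is corrected one letter at a time by a transposition of [D], so it remains a
    bijection of all of [D]. An earlier [u i] distinct from [u n] is fixed; if [u i] equals [u n],
    the transposition is trivial. *)
Lemma same_pattern_rename (D : eqType) n (t u : trace D) :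
  (forall i j, i < n -> j < n -> (t i == t j) = (u i == u j)) ->
  exists2 sigma, bijective sigma & agree n (rename sigma t) u.
Proof.
elim: n => [|n IH] pat; first by exists id => //; exists id.
have [i j lin ljn|sigma bs st] := IH; first by apply: pat; apply: ltnW.
exists (swap (sigma (t n)) (u n) \o sigma).
  by apply: bij_comp bs; apply: swap_bij.
move=> i; rewrite ltnS leq_eqVlt /rename /= => /predU1P[->|lin].
  exact: swapL.
have si : sigma (t i) = u i by exact: st.
have := pat i n (ltnW lin) (ltnSn n).
have [uin tin|uin tin] := eqVneq (u i) (u n).
  by rewrite -(eqP tin) si uin swapxx.
rewrite si swapD //; last exact/eqP.
by rewrite -si => /(bij_inj bs)/eqP; rewrite tin.
Qed.

Lemma infinite_fresh (D : choiceType) (s : seq D) :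
  infinite_set [set: D] -> exists d, d \notin s.
Proof.
move=> infD; apply: contrapT => nfresh; apply: infD.
apply/finite_seqP; exists s; apply/seteqP; split=> //= d _.
by apply: contrapT => /negP ds; apply: nfresh; exists d.
Qed.

(** * König's lemma modulo renamings *)

Section UniformBound.
Variables (D : choiceType) (T : set (trace D)).
Hypothesis infD : infinite_set [set: D].
Hypothesis stableT : stable_under_renamings T.

(** The analogue of a node with infinite subtree: no single length determines all traces through the
    first [n] letters of [t]. *)
Let bad n t :=
  forall N, exists2 u, agree n t u & ~ determined T N u.

Lemma bad_step n t : bad n t -> exists2 u, agree n t u & bad n.+1 u.
Proof.
move=> badt; apply: contrapT => nstep.
pose upd d : trace D := fun i => if i == n then d else t i.
have updt d : agree n t (upd d).
  by move=> i lin; rewrite /upd ltn_eqF.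
have bound d : exists N, forall u, agree n.+1 (upd d) u -> determined T N u.
  apply: contrapT => nb; apply: nstep; exists (upd d) => // N.
  apply: contrapT => nex; apply: nb; exists N => u du.
  by apply: contrapT => ndet; apply: nex; exists u.
have [e efresh] := infinite_fresh (mkseq t n) infD.
have [N NP] := choice bound.
(* Finitely many extensions suffice: by an earlier letter, or by the one fresh letter [e]. *)
pose M := \max_(d <- e :: mkseq t n) N d.
have leM d : d \in e :: mkseq t n -> N d <= M.
  by move=> ds; apply: (leq_bigmax_seq (F := N)).
have [u tu ndet] := badt M.
have updu d : u n = d -> agree n.+1 (upd d) u.
  move=> und i; rewrite ltnS leq_eqVlt /upd => /predU1P[->|lin].
    by rewrite eqxx.
  by rewrite ltn_eqF ?tu.
have neqt i x : i < n -> x \notin mkseq t n -> t i <> x.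
  move=> lin /negP xs tx; apply: xs; apply/mapP.
  by exists i; rewrite ?mem_iota.
have [uns|uns] := boolP (u n \in mkseq t n); apply: ndet.
  apply: determined_leq (NP _ _ (updu _ erefl)).
  by apply: leM; rewrite inE uns orbT.
(* Both [u n] and [e] avoid the first [n] letters, so exchanging them fixes that prefix and carries
   [u] into the cylinder of [upd e]. *)
have bs := swap_bij (u n) e.
apply: (determined_rename stableT bs).
apply: (@determined_leq _ _ (N e)); first by apply: leM; rewrite mem_head.
apply: NP => i; rewrite ltnS leq_eqVlt /upd /rename => /predU1P[->|lin].
  by rewrite eqxx swapL.
by rewrite ltn_eqF // -(tu i lin) swapD //; apply: neqt.
Qed.

Lemma uniformly_determined :
  (forall t, exists n, determined T n t) ->
  exists n, forall t, determined T n t.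
Proof.
move=> det; apply: contrapT => nunif.
have ex N : exists t, ~ determined T N t.
  apply: contrapT => nex; apply: nunif; exists N => t.
  by apply: contrapT => ndet; apply: nex; exists t.
have [t0 _] := ex 0.
have bad0 : bad 0 t0 by move=> N; have [u nu] := ex N; exists u.
(* Badness is a premise inside the existential, so that [choice] yields a total successor
   function. *)
have step (p : nat * trace D) :
    exists u, bad p.1 p.2 -> agree p.1 p.2 u /\ bad p.1.+1 u.
  have [b|nb] := pselect (bad p.1 p.2); last by exists p.2.
  by have [u] := bad_step b; exists u.
have [f fP] := choice step.
pose s := fix s n := if n is k.+1 then f (k, s k) else t0.
have bads n : bad n (s n).
  by elim: n => [//|n IH]; have [] := fP (n, s n) IH.
have agrees n k : agree n (s n) (s (n + k)).
  elim: k => [|k IH]; first by rewrite addn0.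
  apply: agree_trans IH _; rewrite addnS.
  apply: (@agree_leq _ _ (n + k)); first exact: leq_addr.
  by have [] := fP (n + k, s (n + k)) (bads _).
(* The limit of the branch: letter [i] no longer changes from stage [i.+1] on. *)
pose t : trace D := fun i => s i.+1 i.
have agreet n : agree n (s n) t.
  by move=> i lin; rewrite -{1}(subnKC lin) -agrees.
have [n dt] := det t.
(* Badness of [s n] is used with the length [n] that determines [t]; the resulting [u] shares its
   first [n] letters with [t]. *)
have [u su []] := bads n n.
apply: determined_agree dt; apply: agree_trans su.
exact: agree_sym.
Qed.

End UniformBound.

(** * Formulas expressing equality patterns *)

Section PatternFormula.
Variables (DVar : choiceType) (D : eqType) (x : nat -> DVar).
Hypothesis x_inj : injective x.

Definition literal (R : nat -> nat -> bool) k i : bexpr DVar :=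
  let b := BEq (DVarE (x i)) (@DStar DVar) in
  if R i k then b else BNot b.

(** The first conjunct forces the value guessed for [x k] to be the current letter, so the
    existential quantifier acts as a store operation. *)
Definition letter_test R k : bexpr DVar :=
  BAnd (BEq (DVarE (x k)) (@DStar DVar))
    (foldr (fun i b => BAnd (literal R k i) b) (@BTrue DVar) (iota 0 k)).

(* The first [k] letters are already bound; [j] letters remain to be read. *)
Fixpoint pattern_formula (R : nat -> nat -> bool) k j : hmld DVar :=
  if j is j'.+1 then
    Ex (x k) (Dia (letter_test R k) (pattern_formula R k.+1 j'))
  else @Tt DVar.

Lemma fv_pattern R k j y :
  y \in fv (pattern_formula R k j) -> exists2 i, i < k & y = x i.
Proof.
elim: j k => [|j IH] k //=; rewrite !inE => /andP[/eqP yk].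
have low i : i < k.+1 -> y = x i -> exists2 i, i < k & y = x i.
  rewrite ltnS leq_eqVlt => /predU1P[-> //|lik yi]; by exists i.
case/orP; last by move=> /IH[i]; apply: low.
rewrite orbF => /orP[/eqP//|].
(* Keeping only the bound on the indices allows induction over an arbitrary list in place of
   [iota 0 k]. *)
have : all (fun i => i < k) (iota 0 k).
  by apply/allP => i; rewrite mem_iota.
elim: (iota 0 k) => [//|i s IHs] /= /andP[lik /IHs{}IHs].
rewrite inE => /orP[|//]; rewrite /literal; case: ifP => _ /=;
  by rewrite !inE orbF => /eqP ->; exists i.
Qed.

Lemma closed_pattern R n : closed_formula (pattern_formula R 0 n).
Proof.
by apply/fsetP => y; rewrite inE; apply/negP => /fv_pattern[].
Qed.

(** Injectivity of [x] ensures that binding [x k] leaves the stored earlier letters intact. *)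
Lemma letter_testP R k (delta : {fmap DVar -> D}) (t : trace D) d e :
  (forall i, i < k -> delta.[? x i]%fmap = Some (t i)) ->
  bholds delta.[x k <- e]%fmap d (letter_test R k) <->
  e = d /\ forall i, i < k -> (t i == d) = R i k.
Proof.
move=> dt.
have lit i : i < k ->
    bholds delta.[x k <- e]%fmap d (literal R k i) = ((t i == d) == R i k).
  move=> lik; rewrite /literal; case: (R i k) => /=;
  by rewrite fnd_set (inj_eq x_inj) ltn_eqF // dt // ?eqb_id ?eqbF_neg.
have body : bholds delta.[x k <- e]%fmap d
    (foldr (fun i b => BAnd (literal R k i) b) (@BTrue DVar) (iota 0 k)) =
    all (fun i => (t i == d) == R i k) (iota 0 k).
  have : all (fun i => i < k) (iota 0 k).
    by apply/allP => i; rewrite mem_iota.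
  elim: (iota 0 k) => [//|i s IHs] /= /andP[lik /IHs ->].
  by rewrite lit.
rewrite /= body fnd_set eqxx; split.
  move=> /andP[/eqP[ed] /allP all_s]; split=> // i lik.
  by rewrite (eqP (all_s i _)) // mem_iota.
move=> [-> all_s]; rewrite eqxx; apply/allP => i.
by rewrite mem_iota => lik; rewrite all_s.
Qed.

(** The invariant of reading: [delta] stores the letters before position [k], the formula sees the
    tail from [k], and the pairs still to be checked are those whose larger index is at least
    [k]. *)
Lemma sem_pattern R k j (delta : {fmap DVar -> D}) (t : trace D) :
  (forall i, i < k -> delta.[? x i]%fmap = Some (t i)) ->
  sem (pattern_formula R k j) delta (fun p => t (k + p)) <->
  forall i m, i < m -> k <= m < k + j -> (t i == t m) = R i m.
Proof.
elim: j k delta => [|j IH] k delta dt /=.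
  split=> // _ i m _; rewrite addn0 => /andP[lkm].
  by rewrite ltnNge lkm.
have dt' i : i < k.+1 -> (delta.[x k <- t k].[? x i])%fmap = Some (t i).
  rewrite ltnS leq_eqVlt fnd_set (inj_eq x_inj) => /predU1P[->|lik].
    by rewrite eqxx.
  by rewrite ltn_eqF ?dt.
have shift : (fun p => t (k + p)) = scons (t k) (fun p => t (k.+1 + p)).
  by apply: funext => -[|p] /=; rewrite ?addn0 ?addnS.
split=> [[e _ [d [u [tE test su]]]]|pat].
  have dE : d = t k.
    by have := congr1 (fun v : trace D => v 0) tE; rewrite addn0.
  have uE : u = fun p => t (k.+1 + p).
    apply: funext => p; have := congr1 (fun v : trace D => v p.+1) tE.
    by rewrite /= addnS.
  move: test su => /(letter_testP _ _ _ dt)[-> test].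
  rewrite {}uE dE => /(IH _ _ dt') pat i m lim.
  (* Pairs with [m = k] come from the letter test, those with larger [m] from the induction
     hypothesis. *)
  rewrite leq_eqVlt addnS -addSn => /andP[/predU1P[km|lkm] lmj].
    by move: lim; rewrite -km -dE => /test.
  by apply: pat; rewrite // lkm.
exists (t k) => //; exists (t k), (fun p => t (k.+1 + p)); split=> //.
  apply/(letter_testP _ _ _ dt); split=> // i lik.
  by apply: pat; rewrite // leqnn addnS ltnS leq_addr.
apply/(IH _ _ dt') => i m lim /andP[lkm lmj].
by apply: pat; rewrite // (ltnW lkm) addnS -addSn.
Qed.

End PatternFormula.

(** * Stable sets as finite unions of patterns *)

Definition disj (DVar : Type) (s : seq (hmld DVar)) : hmld DVar :=
  foldr (@Or DVar) (@Ff DVar) s.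

Lemma uniformly_determined_definable (D : eqType) (DVar : choiceType)
    (infDVar : infinite_set [set: DVar]) (T : set (trace D)) n :
  stable_under_renamings T -> (forall t, determined T n t) ->
  exists phi : hmld DVar, closed_formula phi /\ closed_sem phi = T.
Proof.
move=> stT det.
have [x x_inj] : exists x : nat -> DVar, injective x.
  move/infiniteP/card_leP: infDVar => [f].
  exists (fun i => val (f (SigSub (in_setT i)))) => i j.
  by move=> /val_inj/(inj (in_setT _) (in_setT _))/(congr1 val).
(* The index type ['I_n.+1] is nonempty even for [n = 0], which makes [inord] available; [F A] reads
   [A] only at indices below [n]. *)
pose pat (t : trace D) : {ffun 'I_n.+1 * 'I_n.+1 -> bool} :=
  [ffun p : 'I_n.+1 * 'I_n.+1 => t p.1 == t p.2].
pose rel (A : {ffun 'I_n.+1 * 'I_n.+1 -> bool}) i j := A (inord i, inord j).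
have patE t i j : i < n -> j < n -> rel (pat t) i j = (t i == t j).
  by move=> lin ljn; rewrite /rel ffunE /= !inordK ?ltnS 1?ltnW.
pose F A := pattern_formula x (rel A) 0 n.
(* Patterns form a finite type, so those realised in [T] can be listed, with membership decided
   classically. *)
pose s := [seq A <- enum {: {ffun 'I_n.+1 * 'I_n.+1 -> bool}} |
            `[< exists2 u, T u & A = pat u >]].
have FP A t : closed_sem (F A) t <->
    forall i m, i < m -> m < n -> (t i == t m) = rel A i m.
  exact: (sem_pattern x_inj (rel A) n (delta := fmap0) (t := t)).
exists (disj (map F s)); split.
  elim: s => [//|A s IH]; rewrite /closed_formula /= in IH *.
  by rewrite IH closed_pattern fsetU0.
have disjP t : closed_sem (disj (map F s)) t <->
    exists2 A, A \in s & closed_sem (F A) t.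
  elim: s => [|A s IH]; first by split=> // -[].
  split=> [[tA|/IH[B Bs tB]]|[B]].
  - by exists A; rewrite ?mem_head.
  - by exists B; rewrite // inE Bs orbT.
  rewrite inE => /predU1P[->|Bs tB]; first by left.
  by right; apply/IH; exists B.
apply/seteqP; split=> t.
  move=> /disjP[A]; rewrite mem_filter => /andP[/asboolP[u Tu ->] _] /FP tu.
  (* [t] has the pattern of some [u] in [T], hence agrees on [n] letters with a renaming of [u],
     which is in [T] by stability. The formula only tests pairs [i < m]; symmetry of equality
     supplies the others. *)
  have [i j lin ljn|sigma bs ut] := @same_pattern_rename _ n u t.
    wlog lij : i j lin ljn / i <= j.
      move=> H; case/orP: (leq_total i j) => lij; first exact: H.
      by rewrite eq_sym [RHS]eq_sym; apply: H.
    move: lij; rewrite leq_eqVlt => /predU1P[->|lij]; first by rewrite !eqxx.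
    by rewrite tu // patE.
  by apply/(det _ _ ut)/stable_rename.
move=> Tt; apply/disjP; exists (pat t).
  by rewrite mem_filter mem_enum andbT; apply/asboolP; exists t.
by apply/FP => i m lim lmn; rewrite patE // (ltn_trans lim).
Qed.

Theorem theorem13 (D : countType) (infD : infinite_set [set: D])
  (DVar : countType) (infDVar : infinite_set [set: DVar])
  (T : set (trace D)) (stableT : stable_under_renamings T) :
  completely_monitorable T <->
  exists phi : hmld DVar, closed_formula phi /\ closed_sem phi = T.
Proof.
split=> [mT|[phi [_ <-]]].
  have [n det] := uniformly_determined infD stableT
    (fun t => monitorable_determined t mT).
  exact: (uniformly_determined_definable infDVar stableT det).
have [n semn] := sem_agree D phi.
apply: (@uniformly_determined_monitorable _ _ n) => t u tu.
by split; apply: semn => //; apply: agree_sym.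
Qed.
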